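(* Let $G$ be a planar multigraph with no loops and with maximum degree at most $3$. Then $G$ contains an induced matching of size at least $|E(G)|/9$.
   Context: Multigraphs are finite; they may have parallel edges. Two distinct edges are adjacent if they share at least one endpoint (so parallel edges are adjacent). An induced matching in a multigraph $G$ is a set $M \subseteq E(G)$ such that no two distinct edges of $M$ are adjacent to each other and no two distinct edges of $M$ are both adjacent to a common edge of $G$. The degree of a vertex is the number of edges incident to it, counted with multiplicity. *)

(* Defs.v *)
(* MathComp / MathComp-Analysis. *)
From HB Require Import structures.
From mathcomp Require Import all_boot all_order all_algebra.
From mathcomp Require Import all_classical all_reals all_analysis.

Set Implicit Arguments.
Unset Strict Implicit.
Unset Printing Implicit Defensive.

Import Order.TTheory GRing.Theory Num.Theory.
Import numFieldNormedType.Exports.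

Local Open Scope classical_set_scope.
Local Open Scope ring_scope.

(* Every edge carries the set of its endpoints: two vertices in general, one
   if the edge is a loop.  Parallel edges have equal sets of endpoints. *)
Record multigraph := Multigraph {
  vertex : finType;
  edge : finType;
  ends : edge -> {set vertex};
  card_ends : forall e : edge, (1 <= #|ends e| <= 2)%N
}.

Definition loop (G : multigraph) (e : edge G) : bool := #|ends e| == 1%N.

Definition loopless (G : multigraph) : Prop := forall e : edge G, ~~ loop e.

(* Meant for loopless multigraphs: a loop would be counted once. *)
Definition degree (G : multigraph) (v : vertex G) : nat :=
  #|[pred e : edge G | v \in ends e]|.

Definition max_degree (G : multigraph) : nat :=
  (\max_(v : vertex G) degree v)%N.

Definition adjacent_edges (G : multigraph) (e f : edge G) : bool :=
  (e != f) && [exists v : vertex G, (v \in ends e) && (v \in ends f)].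

Definition induced_matching (G : multigraph) (M : {set edge G}) : Prop :=
  forall e f : edge G, e \in M -> f \in M -> e != f ->
    ~~ adjacent_edges e f /\ ~ (exists g : edge G, adjacent_edges e g /\ adjacent_edges f g).

(* [pt v] is the point representing the vertex [v], and the restriction of
   [arc e] to [0, 1] is the curve representing the edge [e]. *)
Record plane_drawing (R : realType) (G : multigraph)
    (pt : vertex G -> R * R) (arc : edge G -> R -> R * R) : Prop :=
  PlaneDrawing {
  pt_inj : injective pt;
  arc_continuous : forall e : edge G,
    {within `[0, 1]%classic, continuous (arc e)};
  arc_ends : forall e : edge G, exists u v : vertex G,
    [/\ ends e = [set u; v]%SET, arc e 0 = pt u & arc e 1 = pt v];
  (* The exception s = 0, t = 1 only occurs for loops, whose curves are
     closed: if [e] is not a loop, then arc e 0 <> arc e 1 by [pt_inj]. *)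
  arc_simple : forall (e : edge G) (s t : R),
    0 <= s -> s < t -> t <= 1 -> arc e s = arc e t -> s = 0 /\ t = 1;
  arc_avoids_pt : forall (e : edge G) (v : vertex G) (t : R),
    0 < t < 1 -> arc e t <> pt v;
  arc_disjoint : forall (e f : edge G) (s t : R),
    e != f -> 0 < s < 1 -> 0 < t < 1 -> arc e s <> arc f t
}.

Definition planar (R : realType) (G : multigraph) : Prop :=
  exists (pt : vertex G -> R * R) (arc : edge G -> R -> R * R),
    plane_drawing pt arc.

(* Main.v *)
(* Let [n] be the number of non-isolated vertices.  Since every degree is at
   most 3, [2 |E| <= 3 n], so it suffices to find an induced matching [M] of the
   underlying simple graph with [n <= 6 |M|] (Joos, Rautenbach and Sasse); this
   exists for every subcubic graph without a [K_{3,3}] one edge of which is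
   subdivided.  By induction, it is enough to find one or two edges forming an
   induced matching such that deleting their closed neighbourhood loses at most
   6 non-isolated vertices per edge.  The closed neighbourhood of an edge has at
   most 6 vertices, so a failure means that new isolated vertices appear for
   every choice of the edges, i.e., that there are many short cycles; following
   them rules out leaves, triangles, the cubic case, and vertices of degree 2,
   where the subdivided [K_{3,3}] is the only obstruction.

   The topological input is that a subdivided [K_{3,3}] has no plane drawing.
   For an arc [f] and a point [p] off [f], let [W(f, p)] be the parity of the
   number of crossings of [f] with the horizontal ray to the right of [p].  If
   the arcs [f] and [g] are disjoint, then [f s - g t] maps the unit square to
   the plane minus the origin, so its boundary crosses the ray an even number of
   times: this relates [W(f, g 0) + W(f, g 1) + W(g, f 0) + W(g, f 1)] to the
   relative positions of the endpoints.  Adding these relations over the pairs of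
   disjoint edges of [K_{3,3}], the terms [W] cancel modulo 2, and what is left
   is odd. *)
Require Import Defs.
From HB Require Import structures.
From mathcomp Require Import all_boot all_order all_algebra.
From mathcomp Require Import all_classical all_reals all_analysis.
From mathcomp Require Import zify lra.

Set Implicit Arguments.
Unset Strict Implicit.
Unset Printing Implicit Defensive.

Import Order.TTheory GRing.Theory Num.Theory.

Local Open Scope ring_scope.

(** * Induced matchings in subcubic graphs *)

Section Subcubic.
Local Open Scope nat_scope.
Variable T : finType.
Implicit Types (r : rel T) (M : seq (T * T)) (L : seq T).

(* As [M] will consist of edges, this includes their endpoints. *)
Definition dominated r M x := has (fun e => r e.1 x || r e.2 x) M.

Definition undominated r M : rel T :=
  [rel x y | [&& r x y, ~~ dominated r M x & ~~ dominated r M y]].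

Definition supp r : {set T} := [set x | [exists y, r x y]].

Definition apart r (e f : T * T) :=
  all (fun x => all (fun y => (x != y) && ~~ r x y) [:: f.1; f.2]) [:: e.1; e.2].

Definition rmatching r M := all (fun e => r e.1 e.2) M && pairwise (apart r) M.

(** The classes are [{v, e, f}] and [{w, c, d}], and [u] subdivides the edge [vw]. The copy need not
    be induced. *)
Definition subdivided_K33 r := exists u v w c d e f : T,
  [/\ uniq [:: u; v; w; c; d; e; f], r u v /\ r u w, r v c /\ r v d,
      r w e /\ r w f & [/\ r c e, r c f, r d e & r d f]].

(* [L] lists the dominated vertices and those isolated by their deletion. *)
Definition reducible r := exists M L,
  [/\ M != [::], rmatching r M, size L <= 6 * size M &
      {subset supp r <= [predU L & supp (undominated r M)]}].

Lemma dominated_edge r M e : symmetric r -> rmatching r M -> e \in M ->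
  dominated r M e.1 && dominated r M e.2.
Proof.
move=> rsym /andP[/allP rM _] eM; have := rM _ eM => ree.
by apply/andP; split; apply/hasP; exists e; rewrite // (rsym e.2) ree // orbT.
Qed.

(** Endpoints of [M] are dominated, so an undominated vertex is neither one of them nor adjacent to
    one. Between undominated vertices [r] and [undominated r M] agree, so [apart] transfers. *)
Lemma rmatching_cat r M M' : symmetric r -> rmatching r M ->
  rmatching (undominated r M) M' -> rmatching r (M ++ M').
Proof.
move=> rsym rM /andP[/allP uM' pM']; have /andP[aM pM] := rM.
rewrite /rmatching all_cat pairwise_cat aM pM /=.
have und e : e \in M' -> [/\ r e.1 e.2, ~~ dominated r M e.1 & ~~ dominated r M e.2].
  by move=> /uM' /and3P[].
apply/and3P; split; first by apply/allP => e /und[].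
  apply/allrelP => e f eM /und[_ f1 f2].
  have /andP[e1 e2] := dominated_edge rsym rM eM.
  have nf x y : x \in [:: e.1; e.2] -> ~~ dominated r M y -> (x != y) && ~~ r x y.
    rewrite !inE => xe ny; apply/andP; split.
      apply: contraNneq ny => <-.
      by case/orP: xe => /eqP ->.
    apply: contraNN ny => rxy; apply/hasP; exists e => //.
    by case/orP: xe => /eqP <-; rewrite rxy ?orbT.
  by apply/allP => x xe; apply/allP => y; rewrite !inE => /orP[]/eqP ->; apply: nf.
apply: (@sub_in_pairwise _ (mem M') _ _ _ _ _ pM'); last exact/allP.
move=> e f /und[_ e1 e2] /und[_ f1 f2].
by rewrite /apart /= /undominated /= e1 e2 f1 f2 !andbT.
Qed.

(** Induction on the number of non-isolated vertices: [undominated r M] inherits every hypothesis as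
    a subgraph of [r], and the endpoints of [M] become isolated in it. *)
Lemma matching_of_reducible :
  (forall r, symmetric r -> irreflexive r -> (forall x, #|r x| <= 3) ->
     ~ subdivided_K33 r -> supp r != finset.set0 -> reducible r) ->
  forall r, symmetric r -> irreflexive r -> (forall x, #|r x| <= 3) ->
     ~ subdivided_K33 r -> exists2 M, rmatching r M & #|supp r| <= 6 * size M.
Proof.
move=> red r; move: {2}#|supp r|.+1 (ltnSn #|supp r|) => n.
elim: n r => // n IHn r ltn rsym rirr rdeg rK.
have [->|r0] := eqVneq (supp r) finset.set0; first by exists [::]; rewrite ?cards0.
have [M [L [M0 rM sL sub]]] := red r rsym rirr rdeg rK r0.
set r' := undominated r M in sub.
have r'r : subrel r' r by move=> x y /and3P[].
have ss : supp r' \proper supp r.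
  apply/properP; split.
    by apply/fintype.subsetP => x; rewrite !inE => /existsP[y /r'r xy]; apply/existsP; exists y.
  case: M M0 rM {sub} @r' r'r sL => // e M _ rM r' _ _.
  have /andP[d1 _] := dominated_edge rsym rM (mem_head e M).
  have /andP[/= /andP[ree _] _] := rM.
  exists e.1; first by rewrite inE; apply/existsP; exists e.2.
  by rewrite inE; apply/existsP => -[y /and3P[_]]; rewrite d1.
have [|||||M' rM' sM'] := IHn r'.
- by rewrite -ltnS; apply: leq_trans ltn; rewrite ltnS; apply: proper_card.
- by move=> x y; rewrite /r' /undominated /= rsym; congr andb; rewrite andbC.
- by move=> x; rewrite /r' /undominated /= rirr.
- move=> x; apply: leq_trans (rdeg x); apply: subset_leq_card.
  by apply/fintype.subsetP => y; apply: r'r.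
- move=> [u [v [w [c [d [e [f]]]]]]] [U [? ?] [? ?] [? ?] [? ? ? ?]]; apply: rK.
  by exists u, v, w, c, d, e, f; do ?split; rewrite ?r'r.
exists (M ++ M'); first exact: rmatching_cat.
rewrite size_cat mulnDr; apply: leq_trans (leq_add sL sM').
have /subset_leq_card/leq_trans -> //: supp r \subset [set x in L] :|: supp r'.
  by apply/fintype.subsetP => x /sub; rewrite !inE.
rewrite (leq_trans (leq_card_setU _ _)) // leq_add2r.
by rewrite cardsE card_size.
Qed.

(** * Irreducible graphs: leaves and triangles *)

Section Irreducible.
Variable r : rel T.
Hypotheses (rsym : symmetric r) (rirr : irreflexive r).
Hypothesis rdeg : forall x, #|r x| <= 3.
Hypothesis irred : ~ reducible r.

(** Without such a [z], [M] and [L] would witness [reducible]. The list [L] may exceed the dominated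
    set: filling its spare places with vertices already found forces a new isolated one. *)
Lemma isolated_exists M L : M != [::] -> rmatching r M -> size L <= 6 * size M ->
  (forall x, dominated r M x -> x \in L) ->
  exists z y, [/\ r z y, z \notin L & forall t, r z t -> dominated r M t].
Proof.
move=> M0 rM sL ML; apply: contrapT => N; apply: irred; exists M, L; split=> // x.
rewrite !inE => /existsP[y xy]; apply/orP; have [|xL] := boolP (x \in L); first by left.
right; apply/existsP; apply: contrapT => N'; apply: N; exists x, y; split=> // t xt.
apply: contraT => nt; case: N'; exists t; rewrite /undominated /= xt nt andbT /=.
by apply: contraNN xL => /ML.
Qed.

Lemma isolated1 u v L : r u v -> size L <= 6 ->
  (forall x, r u x || r v x -> x \in L) ->
  exists z y, [/\ r z y, z \notin L & forall t, r z t -> r u t || r v t].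
Proof.
move=> uv sL uL; have [|||x|z [y [zy zL zN]]] := @isolated_exists [:: (u, v)] L => //.
- by rewrite /rmatching /= uv.
- by rewrite /dominated /= orbF => /uL.
by exists z, y; split=> // t /zN; rewrite /dominated /= orbF.
Qed.

Lemma isolated2 u v u' v' L : r u v -> r u' v' -> apart r (u, v) (u', v') ->
  size L <= 12 ->
  (forall x, [|| r u x, r v x, r u' x | r v' x] -> x \in L) ->
  exists z y, [/\ r z y, z \notin L &
    forall t, r z t -> [|| r u t, r v t, r u' t | r v' t]].
Proof.
move=> uv uv' ap sL uL.
have [|||x|z [y [zy zL zN]]] := @isolated_exists [:: (u, v); (u', v')] L => //.
- by rewrite /rmatching /= uv uv' ap.
- by rewrite /dominated /= orbF -orbA => /uL.
by exists z, y; split=> // t /zN; rewrite /dominated /= orbF -orbA.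
Qed.

(* [a], [b], [c] need not be distinct: vertices of smaller degree repeat one. *)
Definition covered x a b c := forall y, r x y -> [\/ y = a, y = b | y = c].

Lemma nbrs_le3 x s : uniq s -> all (r x) s -> size s <= 3.
Proof.
move=> us /allP as_; apply: leq_trans (rdeg x).
by rewrite -(card_uniqP us); apply/subset_leq_card/fintype.subsetP => y /as_.
Qed.

Lemma cover3 x a b : r x a -> r x b -> a != b -> exists2 c, r x c & covered x a b c.
Proof.
move=> xa xb ab.
have [/existsP[c /and3P[xc ca cb]]|/existsPn N] :=
    boolP [exists c, [&& r x c, c != a & c != b]].
  exists c => // y xy; have [->|ya] := eqVneq y a; first by constructor.
  have [->|yb] := eqVneq y b; first by constructor.
  have [->|yc] := eqVneq y c; first by constructor.
  have := @nbrs_le3 x [:: y; c; a; b].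
  by rewrite /= !inE !negb_or ya yb yc ca cb ab xy xc xa xb => /(_ isT isT).
exists a => // y xy; have := N y; rewrite xy /= negb_and !negbK.
by case/orP => /eqP ->; constructor.
Qed.

Lemma cover_uniq x a b c : r x a -> r x b -> r x c -> uniq [:: a; b; c] ->
  covered x a b c.
Proof.
move=> xa xb xc; rewrite /= !inE negb_or => /and3P[/andP[ab ac] bc _].
have [d _ C] := cover3 xa xb ab.
suff -> : c = d by [].
by case: (C c xc) => // E; [rewrite E eqxx in ac | rewrite E eqxx in bc].
Qed.

Lemma cover2 x a : r x a -> exists b c, [/\ r x b, r x c & covered x a b c].
Proof.
move=> xa; have [/existsP[b /andP[xb ba]]|/existsPn N] :=
    boolP [exists b, r x b && (b != a)].
  have ab : a != b by rewrite eq_sym.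
  by have [c xc C] := cover3 xa xb ab; exists b, c.
exists a, a; split=> // y xy; have := N y; rewrite xy /= negbK => /eqP ->.
by constructor.
Qed.

(** Case analysis by saturation: each adjacency is split along the [covered] facts, and symmetric
    copies are added once. A branch dies when it yields a loop or contradicts a recorded inequality
    or non-adjacency. *)
Ltac nbr_step :=
  match goal with
  | H : ?x = ?y |- _ => is_var x; is_var y; subst
  | H : is_true (r ?x ?x) |- _ => exfalso; by rewrite rirr in H
  | H : is_true (?x != ?x) |- _ => exfalso; by rewrite eqxx in H
  | H : is_true (r ?x ?y), H' : is_true (~~ r ?x ?y) |- _ => exfalso; by rewrite H in H'
  | H : is_true (_ && _) |- _ => case/andP: H => ? ?
  | H : is_true (_ \notin _ :: _) |- _ => rewrite !inE !negb_or in H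
  | H : is_true (_ \in _ :: _) |- _ => rewrite !inE in H
  | H : is_true (_ == _) |- _ => move/eqP: H => ?; subst
  | H : is_true (r ?x ?y) |- _ =>
      lazymatch goal with _ : is_true (r y x) |- _ => fail | _ => idtac end;
      have ? : r y x by rewrite rsym
  | C : covered ?a ?b ?c ?d, H : is_true (r ?a ?y) |- _ =>
      assert_fails (constr_eq y b); assert_fails (constr_eq y c);
      assert_fails (constr_eq y d); case: (C y H) => ?; subst
  | H : is_true (_ || _) |- _ => case/orP: H => ?
  end.

Ltac nbr_close :=
  match goal with
  | |- is_true (_ \in _) => by rewrite !inE eqxx ?orbT
  | |- is_true (r _ _) => first [assumption | rewrite rsym; assumption]
  | |- is_true (_ != _) => first [assumption | rewrite eq_sym; assumption]
  | |- is_true (~~ _) => apply/negP => ?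
  end.

Ltac nbr := repeat first [nbr_close | nbr_step].

(* If [u] is a leaf attached to [v], the vertices isolated by [uv] hang from the
   two other neighbours [c] and [d] of [v]; leaves [x] at [c] and [z] at [d] then
   make [cx] and [dz] a good pair. *)
Lemma no_leaf u v : r u v -> exists2 w, w != v & r u w.
Proof.
move=> uv; apply: contrapT => N.
have leaf : covered u v v v.
  by move=> y uy; have [->|yv] := eqVneq y v; [constructor | case: N; exists y].
have vu : r v u by rewrite rsym.
have [c [d [vc vd Cv]]] := cover2 vu.
have cv : r c v by rewrite rsym.
have dv : r d v by rewrite rsym.
have [x1 [y1 [_ _ Cc1]]] := cover2 cv.
have [z1 [t1 [_ _ Cd1]]] := cover2 dv.
(* Listing the neighbours [z1], [t1] of [d] keeps [x] away from [d], so [x] is a leaf at [c]; the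
   next step is symmetric. *)
have [//|q|x [y0 [xy0 xL xN]]] := @isolated1 u v [:: u; v; c; d; z1; t1] uv.
  by case/orP => [/leaf|/Cv] [] ->; rewrite !inE eqxx ?orbT.
have [//|q|z [y2 [zy2 zL zN]]] := @isolated1 u v [:: u; v; c; d; x1; y1] uv.
  by case/orP => [/leaf|/Cv] [] ->; rewrite !inE eqxx ?orbT.
have xc : forall t, r x t -> t = c.
  by move=> t xt; case/orP: (xN t xt) => ?; nbr.
have zd : forall t, r z t -> t = d.
  by move=> t zt; case/orP: (zN t zt) => ?; nbr.
have ? := xc _ xy0; have ? := zd _ zy2; subst y0 y2.
have cx : covered x c c c by move=> t /xc ->; constructor.
have dz : covered z d d d by move=> t /zd ->; constructor.
clear xN zN xc zd.
have [y cy Cc] : exists2 y, r c y & covered c v x y by apply: cover3; [|nbr|nbr].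
have [t dt Cd] : exists2 t, r d t & covered d v z t by apply: cover3; [|nbr|nbr].
(* If [c] and [d] are adjacent, the component consists of the six listed vertices. *)
have [cd|cd] := boolP (r c d).
  have [//|q|s [s0 [ss0 sL sN]]] := @isolated1 u v [:: u; v; c; d; x; z] uv.
    by case/orP => [/leaf|/Cv] [] ->; rewrite !inE eqxx ?orbT.
  by case/orP: (sN _ ss0) => ?; nbr.
have yc : r y c by rewrite rsym.
have td : r t d by rewrite rsym.
have [y2 [y3 [_ _ Cy]]] := cover2 yc.
have [t2 [t3 [_ _ Ct]]] := cover2 td.
(* These 12 entries include all neighbours of the dominated vertices, so nothing outside the list
   gets isolated. *)
have [||||q|s [s0 [ss0 sL sN]]] := @isolated2 c x d z [:: c; d; v; x; y; z; t; u; y2; y3; t2; t3].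
- by nbr.
- by nbr.
- rewrite /apart /= !andbT cd /=.
  by repeat (apply/andP; split); apply/negP => ?; nbr.
- by [].
- by case/or4P => [/Cc|/cx|/Cd|/dz] [] ->; rewrite !inE eqxx ?orbT.
- by case/or4P: (sN _ ss0) => ?; nbr.
Qed.

(** The edge [uv] dominates only [u, v, w, a, b], so it isolates two further vertices, with
    neighbours among [w, a, b]. At most one of them is adjacent to [w]; the other, not being a leaf,
    has exactly the neighbours [a] and [b]. *)
Lemma triangle_apex u v w a b c : r u v -> r v w -> r u w ->
  covered u v w a -> covered v u w b -> covered w u v c -> r w c ->
  exists p, [/\ r p a, r p b, covered p a b b, a != b & p != c].
Proof.
move=> uv vw uw Cu Cv Cw wc.
have far p : p \notin [:: u; v; w; a; b] -> (forall t, r p t -> r u t || r v t) ->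
    covered p w a b.
  move=> pL pN t pt; move: pL; case/orP: (pN t pt) => ? pL; nbr; by constructor.
have apex p t0 : r p t0 -> covered p w a b -> ~~ r p w ->
    exists p, [/\ r p a, r p b, covered p a b b, a != b & p != c].
  move=> pt0 Cp pw; have [t1 t10 pt1] := no_leaf pt0; exists p.
  have Cp' : covered p a b b.
    by move=> t pt; case: (Cp t pt) => ?; subst; [rewrite pt in pw|constructor|constructor].
  by split=> //; nbr.
have [//|q|p [p0 [pp0 pL pN]]] := @isolated1 u v [:: u; v; w; a; b] uv.
  by case/orP => [/Cu|/Cv] [] ->; rewrite !inE eqxx ?orbT.
have [//|t|q [q0 [qq0 qL qN]]] := @isolated1 u v [:: u; v; w; a; b; p] uv.
  by case/orP => [/Cu|/Cv] [] ->; rewrite !inE eqxx ?orbT.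
have Cp := far p pL pN.
have Cq : covered q w a b.
  by apply: far qN; apply: contra qL; rewrite !inE => /or4P[|||/orP[]] ->; rewrite ?orbT.
have [pw|pw] := boolP (r p w); last exact: apex pp0 Cp pw.
have [qw|qw] := boolP (r q w); last exact: apex qq0 Cq qw.
clear far apex; by nbr.
Qed.

(** The apexes of the three edges form a hexagon with [a], [b], [c] around the triangle. This closes
    the component at 9 vertices, where [uv] isolates only [p1], for a loss of 6. *)
Lemma no_triangle u v w : r u v -> r v w -> r u w -> False.
Proof.
move=> uv vw uw.
have wu : r w u by rewrite rsym.
have vu : r v u by rewrite rsym.
have wv : r w v by rewrite rsym.
have [a ua Cu] : exists2 a, r u a & covered u v w a by apply: cover3; nbr.
have [b vb Cv] : exists2 b, r v b & covered v u w b by apply: cover3; nbr.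
have [c wc Cw] : exists2 c, r w c & covered w u v c by apply: cover3; nbr.
have swap x y z t : covered x y z t -> covered x z y t.
  by move=> C s /C[]; constructor.
have [p1 [pa1 pb1 Cp1 ab pc1]] := triangle_apex uv vw uw Cu Cv Cw wc.
have [p2 [pb2 pc2 Cp2 bc pa2]] := triangle_apex vw wu vu (swap _ _ _ _ Cv) (swap _ _ _ _ Cw) Cu ua.
have [p3 [pa3 pc3 Cp3 ac pb3]] := triangle_apex uw wv uv (swap _ _ _ _ Cu) Cw Cv vb.
have pp13 : p1 != p3.
  by apply: contraTneq pc3 => <-; apply/negP => /Cp1[] ?; nbr.
have pp12 : p1 != p2.
  by apply: contraTneq pc2 => <-; apply/negP => /Cp1[] ?; nbr.
have au : r a u by rewrite rsym.
have bv : r b v by rewrite rsym.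
have ap1 : r a p1 by rewrite rsym.
have bp1 : r b p1 by rewrite rsym.
have up1 : u != p1 by apply: contraTneq uv => ->; apply/negP => /Cp1[] ?; nbr.
have vp1 : v != p1 by apply: contraTneq uv => ->; apply/negP => ?; nbr.
have [a3 _ Ca] := cover3 au ap1 up1.
have [b3 _ Cb] := cover3 bv bp1 vp1.
have [//|t|q [q0 [qq0 qL qN]]] := @isolated1 u v [:: u; v; w; a; b; p1] uv.
  by case/orP => [/Cu|/Cv] [] ->; rewrite !inE eqxx ?orbT.
have [q1 q10 qq1] := no_leaf qq0.
have a3E : a3 = p3.
  have ap3 : r a p3 by rewrite rsym.
  by case: (Ca _ ap3) => // ?; nbr.
have b3E : b3 = p2.
  have bp2 : r b p2 by rewrite rsym.
  by case: (Cb _ bp2) => // ?; nbr.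
subst a3 b3; clear pa2 pb3 pc1 ap1 bp1 Cp1 pa1 pb1 swap.
by case/orP: (qN _ qq0) => ?; case/orP: (qN _ qq1) => ?; nbr.
Qed.

(** * Vertices of degree 2 *)

Ltac nbr_tri :=
  match goal with
  | H : is_true (r ?x ?y), H' : is_true (r ?y ?z), H'' : is_true (r ?x ?z) |- _ =>
      by case: (no_triangle H H' H'')
  end.

Ltac nbr3 := repeat first [nbr_close | nbr_tri | nbr_step].

(** If [v] had degree 2 as well, [uv] would dominate only four vertices, hence isolate three others.
    Each of them would be adjacent to both [w] and [c], giving [w] four neighbours with [u]. *)
Lemma deg2_nbr u v w : r u v -> r u w -> v != w -> covered u v w w ->
  exists c d, [/\ r v c, r v d, covered v u c d & uniq [:: u; c; d]].
Proof.
move=> uv uw vw Cu.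
have vu : r v u by rewrite rsym.
have wu : r w u by rewrite rsym.
have [c cu vc] := no_leaf vu.
have uc : u != c by rewrite eq_sym.
have [d vd Cv] := cover3 vu vc uc.
have [|N] := boolP (uniq [:: u; c; d]); first by exists c, d.
have {}Cv : covered v u c c.
  move=> t vt; case: (Cv t vt) => ?; try by constructor.
  by subst t; move: N; rewrite /= !inE !negb_or uc andbT /= negb_and !negbK => /orP[]/eqP <-; constructor.
have iso p : (exists t, r p t) -> p \notin [:: u; v; w; c] -> (forall t, r p t -> r u t || r v t) ->
    r p w /\ r p c.
  move=> [t pt] pL pN; have [s st ps] := no_leaf pt; move: pL.
  by case/orP: (pN _ pt) => ?; case/orP: (pN _ ps) => ? pL; split; nbr3.
have step L : size L <= 6 -> {subset [:: u; v; w; c] <= L} -> exists2 p, p \notin L & r w p /\ r c p.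
  move=> sL LL; have [//|q|p [p0 [pp0 pL pN]]] := @isolated1 u v L uv.
    by move=> H; apply: LL; case/orP: H => [/Cu|/Cv] [] ->; rewrite !inE eqxx ?orbT.
  exists p => //; rewrite -!(rsym p); apply: iso; first by exists p0.
  - by apply: contra pL; apply: LL.
  - by [].
have [//|//|p pL [wp cp]] := step [:: u; v; w; c].
have [//|t|q qL [wq cq]] := step [:: u; v; w; c; p].
  by rewrite !inE => /or4P[] ->; rewrite ?orbT.
have [//|t|s sL [ws cs]] := step [:: u; v; w; c; p; q].
  by rewrite !inE => /or4P[] ->; rewrite ?orbT.
have := @nbrs_le3 w [:: s; q; p; u]; rewrite /= ws wq wp wu !inE !negb_or.
move: pL qL sL; rewrite !inE !negb_or.
move=> /and4P[-> _ _ _] /and5P[-> _ _ _ ->].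
move=> /and5P[-> _ _ _ /andP[-> ->]] /=.
by move=> /(_ isT isT).
Qed.

(* The component then has 7 vertices, all dominated by two suitable edges. *)
Lemma deg2_shared u v w c d f : r u v -> r u w -> v != w -> covered u v w w ->
  covered v u c d -> covered w u c f -> r v c -> r v d -> r w c -> r w f ->
  uniq [:: u; c; d] -> uniq [:: u; c; f] -> False.
Proof.
move=> uv uw vw Cu Cv Cw vc vd wc wf; rewrite /= !inE !negb_or !andbT.
move=> /andP[/andP[uc ud] cd] /andP[/andP[_ uf] cf].
have cv : r c v by rewrite rsym.
have cw : r c w by rewrite rsym.
have [c' cc' Cc] := cover3 cv cw vw.
(* An isolated vertex has neighbours among [w, c, d], and not both [w] and [c], since these are
   adjacent. Hence it is [f] or [c'], and two distinct isolated vertices must be both of these. *)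
have far p p0 : r p p0 -> p \notin [:: u; v; w; c; d] -> (forall t, r p t -> r u t || r v t) ->
    r p d /\ (p = f /\ covered p w d d \/ p = c' /\ covered p c d d).
  move=> pp0 pL pN.
  have Cp : covered p w c d.
    by move=> t pt; move: pL; case/orP: (pN t pt) => ? pL; nbr3; constructor.
  have [p1 p10 pp1] := no_leaf pp0.
  have pd : r p d.
    by case: (Cp _ pp0) => ?; case: (Cp _ pp1) => ?; subst; try done; nbr3.
  split=> //.
  have [pw|pw] := boolP (r p w).
    left; split; first by nbr3.
    move=> t pt; case: (Cp t pt) => ?; [by constructor | | by constructor].
    by nbr3.
  right; split; last first.
    by move=> t pt; case: (Cp t pt) => ?; [subst; rewrite pt in pw|constructor|constructor].
  have pc : r p c.
    by case: (Cp _ pp0) => ?; case: (Cp _ pp1) => ?; subst; try done; try (by rewrite pp0 in pw); try (by rewrite pp1 in pw); nbr3.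
  by nbr3.
have [//|t|p [p0 [pp0 pL pN]]] := @isolated1 u v [:: u; v; w; c; d] uv.
  by case/orP => [/Cu|/Cv] [] ->; rewrite !inE eqxx ?orbT.
have [//|t|q [q0 [qq0 qL qN]]] := @isolated1 u v [:: u; v; w; c; d; p] uv.
  by case/orP => [/Cu|/Cv] [] ->; rewrite !inE eqxx ?orbT.
have [pd pF] := far _ _ pp0 pL pN.
have qL' : q \notin [:: u; v; w; c; d].
  by apply: contra qL; rewrite !inE => /or4P[|||/orP[]] ->; rewrite ?orbT.
have [qd qF] := far _ _ qq0 qL' qN.
have pq : q != p by move: qL; rewrite !inE !negb_or => /and5P[_ _ _ _ /andP[_ ->]].
have [fd [c'd [Cf [Cc' [fL c'L]]]]] : r f d /\ r c' d /\ covered f w d d /\ covered c' c d d /\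
     f \notin [:: u; v; w; c; d] /\ c' \notin [:: u; v; w; c; d].
  by case: pF => -[? ?]; case: qF => -[? ?]; subst; try (by exfalso; rewrite eqxx in pq); do !split.
have fc' : f != c' by case: pF => -[? ?]; case: qF => -[? ?]; subst; nbr.
clear far pN qN pF qF pd qd pL qL qL' pq pp0 qq0.
have df : r d f by rewrite rsym.
have dc' : r d c' by rewrite rsym.
have dv : r d v by rewrite rsym.
have vf : v != f by nbr3.
have [x _ Cd] := cover3 dv df vf.
have [||||t|s [s0 [ss0 sL sN]]] := @isolated2 u w d c' [:: u; v; w; c; d; f; c'].
- by [].
- by [].
- by rewrite /apart /= !andbT; repeat (apply/andP; split); nbr3.
- by [].
- by case/or4P => [/Cu|/Cw|/Cd|/Cc'] [] ->; nbr3.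
- by case/or4P: (sN _ ss0) => ?; nbr3.
Qed.

Definition twin x c d (L : seq T) :=
  [/\ r c x, r d x, covered x c d d & x \notin L].

(* The two vertices isolated by [uv] are [e] and [f], or twins of degree 2
   attached to [c] and [d]. *)
Lemma deg2_side u v w c d e f : r u v -> r u w -> covered u v w w ->
  covered v u c d -> covered w u e f -> r v c -> r v d ->
  uniq [:: u; v; w; c; d; e; f] -> r w e -> r w f ->
  let L := [:: u; v; w; c; d; e; f] in
  (covered e w c d /\ covered f w c d) \/
  exists2 x, twin x c d L &
    [\/ covered e w c d, covered f w c d | exists2 x', twin x' c d L & x' != x].
Proof.
move=> uv uw Cu Cv Cw vc vd UL we wf L.
have far p p0 : r p p0 -> p \notin [:: u; v; w; c; d] -> (forall t, r p t -> r u t || r v t) ->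
    covered p w c d /\ [\/ p = e, p = f | twin p c d L].
  move=> pp0 pL pN.
  have Cp : covered p w c d.
    by move=> t pt; move: pL; case/orP: (pN t pt) => ? pL; nbr3; constructor.
  split=> //; have [pw|pw] := boolP (r p w).
    have wp : r w p by rewrite rsym.
    by case: (Cw _ wp) => ?; [subst; rewrite inE eqxx in pL | constructor | constructor].
  have Cp' : covered p c d d.
    by move=> t pt; case: (Cp t pt) => ?; [subst; rewrite pt in pw|constructor|constructor].
  have [p1 p10 pp1] := no_leaf pp0.
  constructor 3; split=> //.
  - by rewrite rsym; case: (Cp' _ pp0) => ?; case: (Cp' _ pp1) => ?; nbr3.
  - by rewrite rsym; case: (Cp' _ pp0) => ?; case: (Cp' _ pp1) => ?; nbr3.
  - have pe : p != e by apply: contraNneq pw => ->; rewrite rsym.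
    have pf : p != f by apply: contraNneq pw => ->; rewrite rsym.
    by move: pL; rewrite !inE (negbTE pe) (negbTE pf) !orbF.
have [//|t|p [p0 [pp0 pL pN]]] := @isolated1 u v [:: u; v; w; c; d] uv.
  by case/orP => [/Cu|/Cv] [] ->; rewrite !inE eqxx ?orbT.
have [//|t|q [q0 [qq0 qL qN]]] := @isolated1 u v [:: u; v; w; c; d; p] uv.
  by case/orP => [/Cu|/Cv] [] ->; rewrite !inE eqxx ?orbT.
have [Cp pF] := far _ _ pp0 pL pN.
have qL' : q \notin [:: u; v; w; c; d].
  by apply: contra qL; rewrite !inE => /or4P[|||/orP[]] ->; rewrite ?orbT.
have [Cq qF] := far _ _ qq0 qL' qN.
have qp : q != p by move: qL; rewrite !inE !negb_or => /and5P[_ _ _ _ /andP[_ ->]].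
case: pF => pF; case: qF => qF; try (by exfalso; rewrite pF qF eqxx in qp); subst.
- by left.
- by right; exists q => //; constructor.
- by left.
- by right; exists q => //; constructor.
- by right; exists p => //; constructor.
- by right; exists p => //; constructor.
- by right; exists p => //; constructor; exists q.
Qed.

Lemma no_deg2 u v w : ~ subdivided_K33 r -> r u v -> r u w -> v != w ->
  covered u v w w -> False.
Proof.
move=> K33 uv uw vw Cu.
have wv : w != v by rewrite eq_sym.
have swap x y z t : covered x y z t -> covered x y t z.
  by move=> C s /C[]; constructor.
have Cu' : covered u w v v by move=> t /Cu[]; constructor.
have [c [d [vc vd Cv Ucd]]] := deg2_nbr uv uw vw Cu.
have [e [f [we wf Cw Uef]]] := deg2_nbr uw uv wv Cu'.
have Udc : uniq [:: u; d; c] by rewrite (perm_uniq (_ : perm_eq _ [:: u; c; d])) // perm_cons (perm_catC [:: d] [:: c]).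
have Ufe : uniq [:: u; f; e] by rewrite (perm_uniq (_ : perm_eq _ [:: u; e; f])) // perm_cons (perm_catC [:: f] [:: e]).
have ce : c != e by apply/eqP => E; subst; exact: deg2_shared uv uw vw Cu Cv Cw vc vd we wf Ucd Uef.
have cf : c != f by apply/eqP => E; subst; exact: deg2_shared uv uw vw Cu Cv (swap _ _ _ _ Cw) vc vd wf we Ucd Ufe.
have de : d != e by apply/eqP => E; subst; exact: deg2_shared uv uw vw Cu (swap _ _ _ _ Cv) Cw vd vc we wf Udc Uef.
have df : d != f by apply/eqP => E; subst; exact: deg2_shared uv uw vw Cu (swap _ _ _ _ Cv) (swap _ _ _ _ Cw) vd vc wf we Udc Ufe.
have wc : w != c by apply/eqP => E; subst; exact: no_triangle uv vc uw.
have wd : w != d by apply/eqP => E; subst; exact: no_triangle uv vd uw.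
have ve : v != e by apply/eqP => E; subst; exact: no_triangle uw we uv.
have vf : v != f by apply/eqP => E; subst; exact: no_triangle uw wf uv.
have [cd ef] : c != d /\ e != f.
  by move: Ucd Uef; rewrite /= !inE => /and3P[_ -> _] /and3P[_ -> _].
have [uc ud ue uf] : [/\ u != c, u != d, u != e & u != f].
  by move: Ucd Uef; rewrite /= !inE !negb_or => /and3P[/andP[-> ->] _ _] /and3P[/andP[-> ->] _ _].
have [uv' uw' vc' vd' [we' wf']] : [/\ u != v, u != w, v != c, v != d & w != e /\ w != f].
  by do !split; nbr.
have [Dce Dcf Dde Ddf] : [/\ e != c, f != c, e != d & f != d] by split; nbr.
have U1 : uniq [:: u; v; w; c; d; e; f].
  by rewrite /= !inE !negb_or; repeat (apply/andP; split); first [assumption | rewrite eq_sym; assumption | done].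
have U2 : uniq [:: u; w; v; e; f; c; d].
  by rewrite /= !inE !negb_or; repeat (apply/andP; split); first [assumption | rewrite eq_sym; assumption | done].
have [[Ce Cf]|[x [cx dx Cx xL] Px]] := deg2_side uv uw Cu Cv Cw vc vd U1 we wf;
have [[Cc Cd]|[y [ey fy Cy yL] Py]] := deg2_side uw uv Cu' Cw Cv we wf U2 vc vd.
(* The component has just these 7 vertices. If an edge between [{c, d}] and [{e, f}] were missing,
   say [c0 f0], then [v c0] and [w f0] would be apart and dominate everything; so all four are
   present. *)
- clear Ucd Uef Udc Ufe Dce Dcf Dde Ddf swap Cu'.
  have miss c0 f0 : (c0 = c \/ c0 = d) -> (f0 = e \/ f0 = f) -> r c0 f0.
    move=> cE fE; apply: contraT => c0f0.
    have vc0 : r v c0 by case: cE => ->.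
    have wf0 : r w f0 by case: fE => ->.
    have [||||t|s [s0 [ss0 sL sN]]] := @isolated2 v c0 w f0 [:: u; v; w; c; d; e; f].
    + by [].
    + by [].
    + clear U1 U2; rewrite /apart /= !andbT.
      by case: cE => ?; case: fE => ?; subst; repeat (apply/andP; split); nbr3.
    + by [].
    + case: cE => ?; case: fE => ?; subst.
      * by case/or4P => [/Cv|/Cc|/Cw|/Ce] [] ->; nbr.
      * by case/or4P => [/Cv|/Cc|/Cw|/Cf] [] ->; nbr.
      * by case/or4P => [/Cv|/Cd|/Cw|/Ce] [] ->; nbr.
      * by case/or4P => [/Cv|/Cd|/Cw|/Cf] [] ->; nbr.
    + by case/or4P: (sN _ ss0) => ?; case: cE => ?; case: fE => ?; nbr3.
  apply: K33; exists u, v, w, c, d, e, f; split=> //.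
  by split; apply: miss; [left|left|left|right|right|left|right|right].
- have ye : r y e by rewrite rsym.
  by clear -Ce ey yL rirr rsym cd; case: (Ce _ ey) => ?; nbr.
- by case: (Cc _ cx) => ?; nbr.
(* Both sides have two twins, so the component has 11 vertices. The edges [cx] and [ey] dominate all
   of them except [u], which they isolate. *)
- have [x' [cx' dx' Cx' xL'] xx'] : exists2 x', twin x' c d [:: u; v; w; c; d; e; f] & x' != x.
    by case: Px => // H; [case: (H _ ey) => ?| case: (H _ fy) => ?]; nbr.
  have [y' [ey' fy' Cy' yL'] yy'] : exists2 y', twin y' e f [:: u; w; v; e; f; c; d] & y' != y.
    by case: Py => // H; [case: (H _ cx) => ?| case: (H _ dx) => ?]; nbr.
  have vx : v \notin [:: x'; x] by rewrite !inE negb_or; apply/andP; split; nbr.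
  have wy : w \notin [:: y'; y] by rewrite !inE negb_or; apply/andP; split; nbr.
  have {vx}Uvx : uniq [:: v; x'; x] by rewrite /= vx !inE xx'.
  have {wy}Uwy : uniq [:: w; y'; y] by rewrite /= wy !inE yy'.
  have cv : r c v by rewrite rsym.
  have dv : r d v by rewrite rsym.
  have ew : r e w by rewrite rsym.
  have fw : r f w by rewrite rsym.
  have Cc := cover_uniq cv cx' cx Uvx.
  have Cd := cover_uniq dv dx' dx Uvx.
  have Ce := cover_uniq ew ey' ey Uwy.
  have Cf := cover_uniq fw fy' fy Uwy.
  have [||||t|s [s0 [ss0 sL sN]]] := @isolated2 c x e y [:: u; v; w; c; d; e; f; x; x'; y; y'].
  + by [].
  + by [].
  + clear -rsym rirr xL yL xL' yL' cx cx' ey ey' Cc Cx Cx' Cy Cy' Ce ce de cf df ve wc.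
    rewrite /apart /= !andbT.
    by repeat (apply/andP; split); nbr.
  + by [].
  + by case/or4P => [/Cc|/Cx|/Ce|/Cy] [] ->; nbr.
  + by clear Px Py xL xL' yL yL' U1 U2 Ucd Uef Udc Ufe swap Cu' Uvx Uwy; case/or4P: (sN _ ss0) => ?; nbr.
Qed.

(** * The cubic case *)

Lemma covered_full x a b c y z t : covered x a b c -> r x y -> r x z -> r x t ->
  uniq [:: y; z; t] -> [/\ r x a, r x b & r x c].
Proof.
move=> C xy xz xt; rewrite /= !inE negb_or => /and3P[/andP[yz yt] zt _].
by case: (C y xy) => ?; case: (C z xz) => ?; case: (C t xt) => ?; nbr.
Qed.

(** Together with [no_leaf], this makes every non-isolated vertex cubic. *)
Definition third_nbr := forall u v w, r u v -> r u w -> v != w ->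
  exists2 a, r u a & uniq [:: v; w; a].

(* Obtained from the vertex isolated by the edge [ua] of the square [u a p b]. *)
Lemma cubic_square_arm u v a b p c a' b' : third_nbr ->
  r u v -> r u a -> r u b -> uniq [:: v; a; b] -> r p a -> r p b -> r p c -> uniq [:: a; b; c] ->
  r v c -> covered a u p a' -> covered b u p b' ->
  r c a' \/ r b' v /\ r b' a'.
Proof.
move=> third uv ua ub Uu pa pb pc Up vc Ca Cb.
have Cu := cover_uniq uv ua ub Uu.
have Cp := cover_uniq pa pb pc Up.
have [//|t|q [q0 [qq0 qL qN]]] := @isolated1 u a [:: u; v; a; b; p; a'] ua.
  by case/orP => [/Cu|/Ca] [] ->; nbr.
have [q1 q10 qq1] := no_leaf qq0.
have [q2 qq2 Uq] := third _ _ _ qq1 qq0 q10.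
have N4 t : r q t -> [\/ t = v, t = b, t = p | t = a'].
  move=> qt; move: qL; rewrite !inE !negb_or => qL.
  by case/orP: (qN t qt) => ?; nbr3; constructor.
move: qL; rewrite !inE !negb_or => /and5P[qu qa qv qb /andP[qp qa']].
(* Three of the candidates [v, b, p, a'] are neighbours of [q]. If [p] is one, then [q = c];
   otherwise [q] is adjacent to [v, b, a'], and so [q = b']. *)
have [pq|pq] := boolP (r p q).
  have qc : q = c by case: (Cp _ pq) => ?; nbr.
  subst q; left.
  have C : covered c v p a'.
    by move=> t ct; case: (N4 t ct) => ?; subst; [constructor| nbr3 | constructor | constructor].
  by have [] := covered_full C qq1 qq0 qq2 Uq.
have C : covered q v b a'.
  move=> t qt; case: (N4 t qt) => ?; subst; [by constructor | by constructor | | by constructor].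
  by rewrite rsym qt in pq.
have [qv1 qb1 qa1] := covered_full C qq1 qq0 qq2 Uq.
have bq : r b q by rewrite rsym.
by right; case: (Cb _ bq) => ?; nbr.
Qed.

Lemma no_cubic_square u v a b p c : third_nbr ->
  r u v -> r u a -> r u b -> uniq [:: v; a; b] -> r p a -> r p b -> r p c -> uniq [:: a; b; c] ->
  u != p -> r v c -> False.
Proof.
move=> third uv ua ub Uu pa pb pc Up up vc.
have au : r a u by rewrite rsym.
have ap : r a p by rewrite rsym.
have bu : r b u by rewrite rsym.
have bp : r b p by rewrite rsym.
have cv : r c v by rewrite rsym.
have pu : p != u by rewrite eq_sym.
have [a' aa' Ca] := cover3 au ap up.
have [b' bb' Cb] := cover3 bu bp up.
have swap x y z t : covered x y z t -> covered x z y t.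
  by move=> C s /C[]; constructor.
have Uu' : uniq [:: v; b; a] by rewrite (perm_uniq (_ : perm_eq _ [:: v; a; b])) // perm_cons (perm_catC [:: b] [:: a]).
have Up' : uniq [:: c; a; b] by rewrite (perm_uniq (_ : perm_eq _ [:: a; b; c])) // (perm_catC [:: c] [:: a; b]).
have Uu2 : uniq [:: a; b; v] by rewrite (perm_uniq (_ : perm_eq _ [:: v; a; b])) // (perm_catC [:: a; b] [:: v]).
have Up2 : uniq [:: b; a; c].
  by move: Up; rewrite /= !inE !negb_or (eq_sym b a) => /and3P[/andP[-> ->] -> _].
(* The square is read from [u] along [a] and along [b], and from [p]. Every combination of the
   resulting alternatives closes a triangle among [v, c, a', b']. *)
have A1 := cubic_square_arm third uv ua ub Uu pa pb pc Up vc Ca Cb.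
have A2 := cubic_square_arm third uv ub ua Uu' pb pa pc Up2 vc Cb Ca.
have A3 := cubic_square_arm third pc pa pb Up' ua ub uv Uu2 cv (swap _ _ _ _ Ca) (swap _ _ _ _ Cb).
by case: A1 => [?|[? ?]]; case: A3 => [?|[? ?]]; case: A2 => [?|[? ?]]; nbr3.
Qed.

(** A vertex [p] isolated by [uv] has three neighbours among [a, b, c, d], hence two on one side of
    [uv]. They form a square with [p] and that end of [uv], and the third neighbour of [p] is
    adjacent to the other end, as [no_cubic_square] forbids. *)
Lemma no_edge u v : ~ subdivided_K33 r -> r u v -> False.
Proof.
move=> K33 uv0.
have third : third_nbr.
  move=> x y z xy xz yz; have [t xt C] := cover3 xy xz yz.
  have [|N] := boolP (uniq [:: y; z; t]); first by exists t.
  exfalso; apply: (no_deg2 K33 xy xz yz) => s xs; case: (C s xs) => ?; try by constructor.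
  subst s; move: N; rewrite /= !inE !negb_or yz andbT /= negb_and !negbK => /orP[]/eqP <-; [by constructor 1 | by constructor 2].
have vu0 : r v u by rewrite rsym.
have [a av ua] := no_leaf uv0.
have [c cu vc] := no_leaf vu0.
have [b ub] := third _ _ _ ua uv0 av; rewrite /= !inE negb_or => /and3P[/andP[_ ab] vb _].
have [d vd] := third _ _ _ vc vu0 cu; rewrite /= !inE negb_or => /and3P[/andP[_ cd] ud _].
have va : v != a by rewrite eq_sym.
have uc : u != c by rewrite eq_sym.
have Uu : uniq [:: v; a; b] by rewrite /= !inE negb_or va vb ab.
have Uv : uniq [:: u; c; d] by rewrite /= !inE negb_or uc ud cd.
have Cu := cover_uniq uv0 ua ub Uu.
have Cv := cover_uniq vu0 vc vd Uv.
have [//|t|p [p0 [pp0 pL pN]]] := @isolated1 u v [:: u; v; a; b; c; d] uv0.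
  by case/orP => [/Cu|/Cv] [] ->; nbr.
have [p1 p10 pp1] := no_leaf pp0.
have [p2 pp2] := third _ _ _ pp1 pp0 p10.
have N4 t : r p t -> [\/ t = a, t = b, t = c | t = d].
  move=> pt; move: pL; rewrite !inE !negb_or => /and5P[? ? ? ? /andP[? ?]].
  by case/orP: (pN t pt) => ?; nbr3; constructor.
have [ac ad bc bd] : [/\ a != c, a != d, b != c & b != d] by clear pN N4; split; nbr3.
have [up vp] : u != p /\ v != p by move: pL; rewrite !inE !negb_or ![p == _]eq_sym => /and3P[-> -> _].
have S1 : r p a -> r p b -> r p c -> False.
  move=> pa pb pc; apply: (no_cubic_square third uv0 ua ub Uu pa pb pc _ up vc).
  by rewrite /= !inE negb_or ab ac bc.
have S2 : r p a -> r p b -> r p d -> False.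
  move=> pa pb pc; apply: (no_cubic_square third uv0 ua ub Uu pa pb pc _ up vd).
  by rewrite /= !inE negb_or ab ad bd.
have S3 : r p c -> r p d -> r p a -> False.
  move=> pa pb pc; apply: (no_cubic_square third vu0 vc vd Uv pa pb pc _ vp ua).
  by rewrite /= !inE negb_or cd (eq_sym c) ac (eq_sym d) ad.
have S4 : r p c -> r p d -> r p b -> False.
  move=> pa pb pc; apply: (no_cubic_square third vu0 vc vd Uv pa pb pc _ vp ub).
  by rewrite /= !inE negb_or cd (eq_sym c) bc (eq_sym d) bd.
rewrite /= !inE negb_or => /and3P[/andP[_ p12] p02 _].
clear pN third Cu Cv.
case: (N4 _ pp0) => E0; case: (N4 _ pp1) => E1; case: (N4 _ pp2) => E2; rewrite E0 ?E1 E2 in pp0 pp1 pp2 p10 p12 p02;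
  first [by rewrite eqxx in p10 | by rewrite eqxx in p12 | by rewrite eqxx in p02 |
    by apply: S1 | by apply: S2 | by apply: S3 | by apply: S4].
Qed.

End Irreducible.

Lemma subcubic_matching r : symmetric r -> irreflexive r -> (forall x, #|r x| <= 3) ->
  ~ subdivided_K33 r -> exists2 M, rmatching r M & #|supp r| <= 6 * size M.
Proof.
move: r; apply: matching_of_reducible => r rsym rirr rdeg K33 /finset.set0Pn[u].
rewrite inE => /existsP[v uv]; apply: contrapT => N.
exact: (no_edge rsym rirr rdeg N K33 uv).
Qed.
End Subcubic.

(** * Plane drawings *)

Section Parity.
Local Open Scope nat_scope.

Ltac ne := repeat (apply/andP; split); first [assumption | rewrite eq_sym; assumption].

(* [W x y z] stands for the crossing parity of the edge [xy] with the ray from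
   [z], and [L x z] for [z] being below [x]. *)
Lemma K33_parity (T : finType) (r : rel T) (W : T -> T -> T -> bool) (L : rel T) :
  (forall x y, x != y -> L x y (+) L y x) ->
  (forall x y z t, r x y -> r z t -> uniq [:: x; y; z; t] ->
     ~~ odd (W x y z + W x y t + W z t x + W z t y + L x z + L x t + L y z + L y t)) ->
  ~ subdivided_K33 r.
Proof.
move=> La E [u [v [w [c [d [e [f [U [uv uw] [vc vd] [we wf] [ce cf de df]]]]]]]]].
have E' x y z t (xy : r x y) (zt : r z t) :
    [&& x != z, x != t, y != z & y != t] -> x != y -> z != t -> exists k : nat,
    W x y z + W x y t + W z t x + W z t y + L x z + L x t + L y z + L y t = k.*2.
  move=> /and4P[xz xt yz yt] xy' zt'.
  have : ~~ odd (W x y z + W x y t + W z t x + W z t y + L x z + L x t + L y z + L y t).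
    by apply: E; rewrite //= !inE !negb_or xz xt yz yt xy' zt'.
  by move=> /even_halfK <-; eexists.
have A x y : x != y -> L x y + L y x = 1.
  by move=> /La; case: (L x y); case: (L y x).
move: U; rewrite /= !inE !negb_or.
move=> /and5P[/and5P[Uuv Uuw Uuc Uud /andP[Uue Uuf]] /and5P[Uvw Uvc Uvd Uve Uvf]
   /and4P[Uwc Uwd Uwe Uwf] /and3P[Ucd Uce Ucf] /and3P[/andP[Ude Udf] Uef _]].
(* The only pairs whose [L] terms do not cancel: in the sum below, [L x y] and [L y x] occur three
   times each for the pairs in [{w, c, d}], contributing 9 in total. This depends on the order of
   the edges within each relation. *)
have := A _ _ Ucd; have := A _ _ Uwc; have := A _ _ Uwd.
(* There are 14 disjoint pairs avoiding the subdivided edge, and 8 that involve one of its halves.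
   Each [W] term occurs twice, and every remaining [L] term an even number of times. *)
have [k0 P0] := E' _ _ _ _ vc de ltac:(ne) ltac:(ne) ltac:(ne).
have [k1 P1] := E' _ _ _ _ vc we ltac:(ne) ltac:(ne) ltac:(ne).
have [k2 P2] := E' _ _ _ _ vd ce ltac:(ne) ltac:(ne) ltac:(ne).
have [k3 P3] := E' _ _ _ _ vd we ltac:(ne) ltac:(ne) ltac:(ne).
have [k4 P4] := E' _ _ _ _ vc df ltac:(ne) ltac:(ne) ltac:(ne).
have [k5 P5] := E' _ _ _ _ vc wf ltac:(ne) ltac:(ne) ltac:(ne).
have [k6 P6] := E' _ _ _ _ vd cf ltac:(ne) ltac:(ne) ltac:(ne).
have [k7 P7] := E' _ _ _ _ vd wf ltac:(ne) ltac:(ne) ltac:(ne).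
have [k8 P8] := E' _ _ _ _ ce df ltac:(ne) ltac:(ne) ltac:(ne).
have [k9 P9] := E' _ _ _ _ ce wf ltac:(ne) ltac:(ne) ltac:(ne).
have [k10 P10] := E' _ _ _ _ de cf ltac:(ne) ltac:(ne) ltac:(ne).
have [k11 P11] := E' _ _ _ _ de wf ltac:(ne) ltac:(ne) ltac:(ne).
have [k12 P12] := E' _ _ _ _ we cf ltac:(ne) ltac:(ne) ltac:(ne).
have [k13 P13] := E' _ _ _ _ we df ltac:(ne) ltac:(ne) ltac:(ne).
have [k14 P14] := E' _ _ _ _ uv ce ltac:(ne) ltac:(ne) ltac:(ne).
have [k15 P15] := E' _ _ _ _ uw ce ltac:(ne) ltac:(ne) ltac:(ne).
have [k16 P16] := E' _ _ _ _ uv de ltac:(ne) ltac:(ne) ltac:(ne).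
have [k17 P17] := E' _ _ _ _ uw de ltac:(ne) ltac:(ne) ltac:(ne).
have [k18 P18] := E' _ _ _ _ uv cf ltac:(ne) ltac:(ne) ltac:(ne).
have [k19 P19] := E' _ _ _ _ uw cf ltac:(ne) ltac:(ne) ltac:(ne).
have [k20 P20] := E' _ _ _ _ uv df ltac:(ne) ltac:(ne) ltac:(ne).
have [k21 P21] := E' _ _ _ _ uw df ltac:(ne) ltac:(ne) ltac:(ne).
move=> A1 A2 A3; move: A1 A2 A3 P0 P1 P2 P3 P4 P5 P6 P7 P8 P9 P10 P11 P12 P13 P14 P15 P16 P17 P18 P19 P20 P21.
clear.
repeat match goal with |- context [nat_of_bool ?b] => move: (nat_of_bool b) => ? end.
lia.
Qed.

End Parity.

(** * Crossing parities of two disjoint arcs *)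

Section Crossing.
Import numFieldNormedType.Exports.
Local Open Scope classical_set_scope.
Local Open Scope ring_scope.
Variable R : realType.
Implicit Types (p q : R * R) (f g : R -> R * R) (D : nat -> nat -> R * R).

(* Ties are broken so that exactly one of [p] and [- p] is lower if [p != 0]. *)
Definition lower p := (p.2 < 0) || (p.2 == 0) && (p.1 < 0).

(* Whether the segment [pq] crosses the positive horizontal axis, provided that
   it stays in an open half-plane as in [one_sided]. *)
Definition crossing p q := (lower p (+) lower q) && (0 < p.1).

(** The parity [W(f, p)], computed on the polygon through [n + 1] samples of [f]. *)
Definition winding n f p :=
  \big[addb/false]_(i < n) crossing (f (i%:R / n%:R) - p) (f (i.+1%:R / n%:R) - p).

(** A checkable form of not surrounding the origin: a common open half-plane bounded by a coordinate
    axis. *)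
Definition one_sided (s : seq (R * R)) :=
  [|| all (fun p => 0 < p.1) s, all (fun p => p.1 < 0) s,
      all (fun p => 0 < p.2) s | all (fun p => p.2 < 0) s].

Lemma lowerN p : p != 0 -> lower (- p) = ~~ lower p.
Proof.
case: p => x y; rewrite /lower /= !oppr_lt0 oppr_eq0 -pair_eqE /= negb_and.
by case: (ltgtP x 0) => hx; case: (ltgtP y 0) => hy //=; rewrite ?eqxx.
Qed.

Lemma lowerBC p q : p != q -> lower (p - q) (+) lower (q - p).
Proof. by move=> pq; rewrite -(opprB p q) lowerN ?subr_eq0 // addbN addbb. Qed.

Lemma one_sided_neq0 p s : one_sided s -> p \in s -> p != 0.
Proof.
move=> /or4P[]/allP H /H; apply: contraTneq => ->; by rewrite ltxx.
Qed.

(** Points that differ in [lower] share neither the open upper nor the open lower half-plane, so the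
    common one is left or right. *)
Lemma lower2 p q : one_sided [:: p; q] -> lower p (+) lower q ->
  (0 < p.1) = (0 < q.1) /\ (p.1 != 0).
Proof.
case: p q => x y [x' y']; rewrite /one_sided /lower /=.
by case: (ltgtP x 0) => hx; case: (ltgtP x' 0) => hx'; case: (ltgtP y 0) => hy;
  case: (ltgtP y' 0) => hy' //=; rewrite ?eqxx.
Qed.

(** Negation exchanges the two halves of the horizontal axis, and [lower p (+) lower q] counts the
    crossings of the whole axis. *)
Lemma crossingN p q : one_sided [:: p; q] ->
  crossing (- p) (- q) = crossing p q (+) (lower p (+) lower q).
Proof.
move=> pq; rewrite /crossing !lowerN ?(one_sided_neq0 pq) ?inE ?eqxx ?orbT //.
rewrite addNb addbN negbK; case E : (_ (+) _) => //=.
have [_] := lower2 pq E; rewrite oppr_gt0 => /negbTE.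
by case: ltgtP.
Qed.

(** The boundary of a cell crosses the ray evenly. On the right all crossings count and telescope,
    on the left none does, and above or below the axis [lower] is constant. *)
Lemma crossing_cell p q p' q' : one_sided [:: p; q; p'; q'] ->
  crossing p q (+) crossing p' q' = crossing p p' (+) crossing q q'.
Proof.
rewrite /crossing /one_sided /= !andbT => /or4P[] /and4P[h1 h2 h3 h4].
- rewrite h1 h2 h3 !andbT.
  by case: (lower p); case: (lower q); case: (lower p'); case: (lower q').
- by rewrite (lt_gtF h1) (lt_gtF h2) (lt_gtF h3) !andbF.
- have L t : 0 < t.2 -> lower t = false by move=> t0; rewrite /lower lt_gtF // gt_eqF.
  by rewrite !(L p, L q, L p', L q').
- by rewrite /lower h1 h2 h3 h4.
Qed.

(** Summing over the cells, the interior sides cancel modulo 2. *)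
Lemma crossing_grid D n m :
  (forall i j, (i < n)%N -> (j < m)%N ->
     one_sided [:: D i j; D i.+1 j; D i j.+1; D i.+1 j.+1]) ->
  \big[addb/false]_(i < n) crossing (D i 0%N) (D i.+1 0%N) (+)
  \big[addb/false]_(i < n) crossing (D i m) (D i.+1 m) =
  \big[addb/false]_(j < m) crossing (D 0%N j) (D 0%N j.+1) (+)
  \big[addb/false]_(j < m) crossing (D n j) (D n j.+1).
Proof.
move=> H.
have strip j : (j < m)%N ->
    \big[addb/false]_(i < n) crossing (D i j) (D i.+1 j) (+)
    \big[addb/false]_(i < n) crossing (D i j.+1) (D i.+1 j.+1) =
    crossing (D 0%N j) (D 0%N j.+1) (+) crossing (D n j) (D n j.+1).
  move=> jm; have {}H i : (i < n)%N -> _ := H i j ^~ jm.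
  elim: n H => [_|n IHn H]; first by rewrite !big_ord0 !addbb.
  rewrite !big_ord_recr /= addbACA IHn => [|i /leqW/H //].
  rewrite (crossing_cell (H n (ltnSn n))) addbA -[X in X (+) _]addbA addbb addbF //.
elim: m strip {H} => [_|m IHm strip]; first by rewrite !big_ord0 !addbb.
rewrite !big_ord_recr /= addbACA -IHm => [|j /leqW/strip //].
rewrite -(strip m (ltnSn m)).
by rewrite -addbA addKb.
Qed.

Lemma telescope_addb (F : nat -> bool) n :
  \big[addb/false]_(j < n) (F j (+) F j.+1) = F 0%N (+) F n.
Proof.
elim: n => [|n IHn]; first by rewrite big_ord0 addbb.
by rewrite big_ord_recr /= IHn -addbA addKb.
Qed.

Lemma winding_grid f g n : (0 < n)%N ->
  (forall i j, (i < n)%N -> (j < n)%N ->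
     one_sided [seq f s - g t | t <- [:: j%:R / n%:R; j.+1%:R / n%:R], s <- [:: i%:R / n%:R; i.+1%:R / n%:R]]) ->
  winding n f (g 0) (+) winding n f (g 1) (+) winding n g (f 0) (+) winding n g (f 1) =
  lower (g 0 - f 0) (+) lower (g 1 - f 0) (+) lower (g 0 - f 1) (+) lower (g 1 - f 1).
Proof.
move=> n0 H.
have nn : n%:R / n%:R = 1 :> R by rewrite divff // pnatr_eq0 -lt0n.
have := @crossing_grid (fun i j => f (i%:R / n%:R) - g (j%:R / n%:R)) n n.
rewrite !mul0r nn => /(_ H); rewrite -!/(winding _ _ _).
(* On the sides with [s] fixed, [f s - g t] is the negative of [g t - f s]; by [crossingN] this
   costs [lower] terms, which telescope. *)
have turn s : (exists2 i, (i < n)%N & s = i%:R / n%:R \/ s = i.+1%:R / n%:R) ->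
    \big[addb/false]_(j < n) crossing (f s - g (j%:R / n%:R)) (f s - g (j.+1%:R / n%:R)) =
    winding n g (f s) (+) (lower (g 0 - f s) (+) lower (g 1 - f s)).
  move=> [i im si].
  rewrite (eq_bigr (fun j : 'I_n => crossing (g (j%:R / n%:R) - f s) (g (j.+1%:R / n%:R) - f s) (+)
       (lower (g (j%:R / n%:R) - f s) (+) lower (g (j.+1%:R / n%:R) - f s)))); last first.
    move=> j _; rewrite -!(opprB (g _) (f s)) crossingN //.
    have := H i j im (ltn_ord j); case: si => ->; rewrite /one_sided /= !subr_gt0 !subr_lt0.
      by case/or4P => /and5P[h1 h2 h3 h4 _]; rewrite ?h1 ?h3 ?orbT.
    by case/or4P => /and5P[h1 h2 h3 h4 _]; rewrite ?h2 ?h4 ?orbT.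
  rewrite big_split; congr addb.
  by rewrite (telescope_addb (fun j => lower (g (j%:R / n%:R) - f s))) mul0r nn.
rewrite !turn; last 2 first.
- by exists n.-1; rewrite ?prednK //; right; rewrite nn.
- by exists 0%N => //; left; rewrite mul0r.
move=> ->.
move: (winding n g (f 0)) (winding n g (f 1)) (lower (g 0 - f 0))
  (lower (g 1 - f 0)) (lower (g 0 - f 1)) (lower (g 1 - f 1)).
by do 6 case.
Qed.

Lemma one_sided_near (f g : R -> R * R) (x y : R) :
  {within `[0, 1]%classic, continuous f} -> {within `[0, 1]%classic, continuous g} ->
  0 <= x <= 1 -> 0 <= y <= 1 -> f x <> g y ->
  exists2 d : R, 0 < d & forall S T : seq R,
    {in S, forall s : R, 0 <= s <= 1 /\ `|x - s| < d} ->
    {in T, forall t : R, 0 <= t <= 1 /\ `|y - t| < d} ->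
    one_sided [seq f s - g t | t <- T, s <- S].
Proof.
move=> /subspace_continuousP cf /subspace_continuousP cg x01 y01 fg.
have cl (h : R -> R * R) (z : R) : h @ within `[0, 1]%classic (nbhs z) --> h z ->
   forall e : R, 0 < e -> exists2 d : R, 0 < d &
     forall s : R, 0 <= s <= 1 -> `|z - s| < d -> `|(h z).1 - (h s).1| < e /\ `|(h z).2 - (h s).2| < e.
  move=> /cvg_ballP hz e e0; have := hz e e0.
  rewrite near_withinE => /nbhs_ballP[d d0 H]; exists d => // s s01 zs.
  have s01' : `[0, 1]%classic s by rewrite /= in_itv.
  by have [] := H s zs s01'.
have x01' : `[0, 1]%classic x by rewrite /= in_itv.
have y01' : `[0, 1]%classic y by rewrite /= in_itv.
set u := f x; set v := g y.
have key (e : R) (P : pred (R * R)) : 0 < e ->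
    (forall p q, `|u.1 - p.1| < e /\ `|u.2 - p.2| < e ->
       `|v.1 - q.1| < e /\ `|v.2 - q.2| < e -> P (p - q)) ->
    exists2 d : R, 0 < d & forall S T : seq R,
      {in S, forall s : R, 0 <= s <= 1 /\ `|x - s| < d} ->
      {in T, forall t : R, 0 <= t <= 1 /\ `|y - t| < d} ->
      all P [seq f s - g t | t <- T, s <- S].
  move=> e0 HP.
  have [d1 d10 H1] := cl f x (cf x x01') e e0.
  have [d2 d20 H2] := cl g y (cg y y01') e e0.
  exists (Num.min d1 d2) => [|S T HS HT]; first by rewrite lt_min d10.
  apply/allP => _ /allpairsP[[t s] [/= tT sS ->]].
  have [s01] := HS s sS; have [t01] := HT t tT; rewrite !lt_min => /andP[_ yt] /andP[xs _].
  by apply: HP; [apply: H1 | apply: H2].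
(* Some coordinate of [u] and [v] differs; moving each point by less than half the gap preserves its
   order. *)
have [uv1|vu1|uv1] := ltgtP u.1 v.1.
- have [||d d0 Hd] := key ((v.1 - u.1) / 2) (fun p => p.1 < 0).
  + by lra.
  + by move=> p q; rewrite !ltr_norml /=; lra.
  by exists d => // S T HS HT; rewrite /one_sided Hd ?orbT.
- have [||d d0 Hd] := key ((u.1 - v.1) / 2) (fun p => 0 < p.1).
  + by lra.
  + by move=> p q; rewrite !ltr_norml /=; lra.
  by exists d => // S T HS HT; rewrite /one_sided Hd ?orbT.
have [uv2|vu2|uv2] := ltgtP u.2 v.2.
- have [||d d0 Hd] := key ((v.2 - u.2) / 2) (fun p => p.2 < 0).
  + by lra.
  + by move=> p q; rewrite !ltr_norml /=; lra.
  by exists d => // S T HS HT; rewrite /one_sided Hd ?orbT.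
- have [||d d0 Hd] := key ((u.2 - v.2) / 2) (fun p => 0 < p.2).
  + by lra.
  + by move=> p q; rewrite !ltr_norml /=; lra.
  by exists d => // S T HS HT; rewrite /one_sided Hd ?orbT.
by case: fg; rewrite -/u -/v (surjective_pairing u) uv1 uv2 -surjective_pairing.
Qed.

(** Compactness of the unit square makes the radius of [one_sided_near] uniform. *)
Lemma one_sided_grid f g :
  {within `[0, 1]%classic, continuous f} -> {within `[0, 1]%classic, continuous g} ->
  (forall s t : R, 0 <= s <= 1 -> 0 <= t <= 1 -> f s <> g t) ->
  \forall n \near \oo, forall i j, (i < n)%N -> (j < n)%N ->
    one_sided [seq f s - g t | t <- [:: j%:R / n%:R; j.+1%:R / n%:R],
                               s <- [:: i%:R / n%:R; i.+1%:R / n%:R]].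
Proof.
move=> cf cg fg.
pose K := `[0, 1]%classic `*` `[0, 1]%classic : set (R * R).
pose P (n : nat) (z : R * R) := forall S T : seq R,
  {in S, forall s : R, 0 <= s <= 1 /\ `|z.1 - s| <= n%:R^-1} ->
  {in T, forall t : R, 0 <= t <= 1 /\ `|z.2 - t| <= n%:R^-1} ->
  one_sided [seq f s - g t | t <- T, s <- S].
have cK : compact K by apply: compact_setX; apply: segment_compact.
have /compact_near_coveringP/(_ nat \oo%classic P _) H := cK.
have {H} : \forall n \near \oo, K `<=` P n.
  apply: H => -[x y] [/= xK yK].
  have x01 : 0 <= x <= 1 by move: xK; rewrite /= in_itv.
  have y01 : 0 <= y <= 1 by move: yK; rewrite /= in_itv.
  have [d d0 Hd] := one_sided_near cf cg x01 y01 (fg _ _ x01 y01).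
  (* Half of [d] is for moving the centre, the other half for the mesh [1 / n]. *)
  exists (ball (x, y) (d / 2), [set n : nat | n%:R^-1 < d / 2]).
    split; first by apply: nbhsx_ballx; lra.
    near=> n => /=; rewrite invf_plt ?posrE; [|by near: n; exact: nbhs_infty_gtr|lra].
    by near: n; exact: nbhs_infty_gtr.
  move=> [[x' y'] n] [[/= xx' yy'] nd] S T HS HT; apply: Hd => [s /HS[s01 xs]|t /HT[t01 yt]].
    split=> //; move: xx' xs; rewrite /ball /= !ltr_norml ler_norml /=; lra.
  split=> //; move: yy' yt; rewrite /ball /= !ltr_norml ler_norml /=; lra.
apply: filterS => n KP i j ni nj.
have n0 : 0 < n%:R :> R by rewrite ltr0n (leq_trans _ ni).
have grid k : (k < n)%N -> {in [:: k%:R / n%:R; k.+1%:R / n%:R], forall s : R,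
    0 <= s <= 1 /\ `|k%:R / n%:R - s| <= n%:R^-1}.
  move=> kn s; rewrite !inE => /orP[]/eqP ->.
    rewrite subrr normr0 invr_ge0 (ltW n0) divr_ge0 ?ler0n //=.
    by rewrite ler_pdivrMr // mul1r ler_nat ltnW.
  rewrite -mulrBl -natr1 opprD addNKr mulN1r normrN ger0_norm ?invr_ge0 ?ler0n // lexx.
  by rewrite natr1 divr_ge0 ?ler0n //= ler_pdivrMr // mul1r ler_nat.
have n01 k : (k < n)%N -> 0 <= (k%:R / n%:R : R) <= 1.
  by move=> kn; have [] := grid k kn (k%:R / n%:R) (mem_head _ _).
apply: (KP (i%:R / n%:R, j%:R / n%:R)); [|exact: grid|exact: grid].
by split; rewrite /= in_itv n01.
Unshelve. all: by end_near.
Qed.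
End Crossing.

(** * Back to multigraphs *)

Section Multigraph.
Local Open Scope nat_scope.
Variable G : multigraph.
Implicit Types (e f g : edge G) (x y v w : vertex G).

Definition adjacent x y := (x != y) && [exists e : edge G, ends e == [set x; y]%SET].

Lemma adjacentP x y : reflect (x != y /\ exists e, ends e = [set x; y]%SET) (adjacent x y).
Proof. by apply: (iffP andP) => -[xy /exists_eqP]. Qed.

Lemma adjacent_sym : symmetric adjacent.
Proof.
move=> x y; rewrite /adjacent eq_sym; congr andb.
by apply: eq_existsb => e; rewrite finset.setUC.
Qed.

Lemma adjacent_irr : irreflexive adjacent.
Proof. by move=> x; rewrite /adjacent eqxx. Qed.

Hypothesis Gloopless : loopless G.

Lemma card_ends2 e : #|ends e| = 2.
Proof.
have := Gloopless e; have := card_ends e; rewrite /loop.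
by case: #|ends e| => [|[|[|]]].
Qed.

Lemma adjacent_ends e x y : x \in ends e -> y \in ends e -> x != y ->
  ends e = [set x; y]%SET.
Proof.
move=> xe ye xy; apply/esym/eqP; rewrite eqEcard card_ends2 cards2 xy andbT.
by apply/fintype.subsetP => z; rewrite !inE => /orP[]/eqP ->.
Qed.

Lemma ends_adjacent e x y : x \in ends e -> y \in ends e -> x != y -> adjacent x y.
Proof.
by move=> xe ye xy; apply/adjacentP; split=> //; exists e; apply: adjacent_ends.
Qed.

Lemma other_end e x : x \in ends e -> exists2 y, y \in ends e & x != y.
Proof.
move=> xe; have /card_gt0P[y] : 0 < #|(ends e :\ x)%SET|.
  by have := cardsD1 x (ends e); rewrite card_ends2 xe add1n => -[<-].
by rewrite !inE eq_sym => /andP[xy ye]; exists y.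
Qed.

(** Choosing an edge to each neighbour gives an injection into the edges at [x]; parallel edges only
    raise the degree. *)
Lemma card_adjacent x : #|adjacent x| <= degree x.
Proof.
pose h y := [pick e | ends e == [set x; y]%SET].
have hP y : adjacent x y -> exists2 e, h y = Some e & ends e = [set x; y]%SET.
  move=> /andP[_ /existsP[e eE]]; rewrite /h; case: pickP => [e' /eqP|/(_ e)]; first by exists e'.
  by rewrite eE.
rewrite -(@card_in_imset _ _ h); last first.
  move=> y y' xy /hP[e' he' eE']; have [e he eE] := hP y xy.
  rewrite he he' => -[ee']; have : y \in ends e' by rewrite -ee' eE !inE eqxx orbT.
  rewrite eE' !inE => /orP[/eqP yx|/eqP //].
  by have := xy : adjacent x y; rewrite yx adjacent_irr.
apply: (@leq_trans #|(Some @: [pred e | x \in ends e])%SET|); last first.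
  by rewrite card_imset //; exact: Some_inj.
apply/subset_leq_card/fintype.subsetP => _ /imsetP[y /hP[e he eE] ->].
by rewrite he imset_f // inE eE !inE eqxx.
Qed.

Lemma double_card_edge : \sum_(x : vertex G) degree x = #|edge G| * 2.
Proof.
rewrite /degree; under eq_bigr => x _ do rewrite -sum1_card.
rewrite (exchange_big_dep xpredT) //=.
rewrite (eq_bigr (fun=> 2)) => [|e _]; last first.
  by rewrite sum1_card card_ends2.
by rewrite sum_nat_const.
Qed.

Lemma card_edge_supp : max_degree G <= 3 -> #|edge G| * 2 <= 3 * #|supp adjacent|.
Proof.
move=> Gdeg; rewrite -double_card_edge (bigID (mem (supp adjacent))) /=.
rewrite [X in _ + X]big1 ?addn0 => [|x xs].
  rewrite mulnC -sum_nat_const; apply: leq_sum => x _; apply: leq_trans Gdeg.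
  exact: (leq_bigmax (F := @degree G)).
apply/eqP; rewrite -leqn0 leqNgt; apply: contra xs => /card_gt0P[e xe].
have [y ye xy] := other_end xe.
by rewrite inE; apply/existsP; exists y; apply: ends_adjacent xe ye xy.
Qed.

Definition edges_apart e f := forall x y, x \in ends e -> y \in ends f ->
  x != y /\ ~~ adjacent x y.

Lemma edges_apart_sym e f : edges_apart e f -> edges_apart f e.
Proof. by move=> ef x y xf ye; have [xy a] := ef y x ye xf; rewrite eq_sym adjacent_sym. Qed.

Lemma edges_of_rmatching (M : seq (vertex G * vertex G)) : rmatching adjacent M ->
  exists A : {set edge G}, [/\ #|A| = size M,
    forall e, e \in A -> exists2 p, p \in M & ends e = [set p.1; p.2]%SET &
    forall e f, e \in A -> f \in A -> e != f -> edges_apart e f].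
Proof.
elim: M => [|p M IHM]; first by exists finset.set0; rewrite cards0; split=> // e; rewrite inE.
rewrite /rmatching /= => /andP[/andP[pa Ma] /andP[/allP pM Mp]].
have [|A [cA AM Ap]] := IHM; first by rewrite /rmatching Ma.
have [_ [e eE]] := adjacentP _ _ pa.
have eA f : f \in A -> edges_apart e f.
  move=> /AM[q /pM]; rewrite /apart /= !andbT => H fE x y.
  rewrite eE fE !inE; case/andP: H => /andP[/andP[? ?] /andP[? ?]] /andP[/andP[? ?] /andP[? ?]].
  by move=> /orP[]/eqP -> /orP[]/eqP ->.
(* Otherwise [e] would be apart from itself, although it shares [p.1] with itself. *)
have eNA : e \notin A.
  apply/negP => /eA /(_ p.1 p.1); rewrite eqxx eE !inE eqxx => /(_ isT isT)[//].
exists (e |: A)%SET; split; first by rewrite cardsU1 eNA cA.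
- move=> f; rewrite !inE => /orP[/eqP ->|/AM[q qM fE]]; first by exists p; rewrite ?mem_head.
  by exists q; rewrite // inE qM orbT.
- move=> f g; rewrite !inE => /orP[/eqP ->|fA] /orP[/eqP ->|gA]; first by rewrite eqxx.
  + by move=> _; apply: eA.
  + by move=> _; apply/edges_apart_sym/eA.
  + exact: Ap.
Qed.

Lemma edges_apart_induced (A : {set edge G}) :
  (forall e f, e \in A -> f \in A -> e != f -> edges_apart e f) -> induced_matching A.
Proof.
move=> H e f eA fA ef; have {}H := H e f eA fA ef; split.
  apply/negP => /andP[_ /existsP[v /andP[ve vf]]].
  by have [] := H v v ve vf; rewrite eqxx.
move=> [g [/andP[_ /existsP[v /andP[ve vg]]] /andP[_ /existsP[w /andP[wf wg]]]]].
by have [vw /negP] := H v w ve wf; apply; apply: ends_adjacent vg wg vw.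
Qed.

End Multigraph.

(** * Drawings contain no subdivided K_{3,3} *)

Section Drawing.
Variables (R : realType) (G : multigraph) (pt : vertex G -> R * R) (arc : edge G -> R -> R * R).
Hypothesis Gdraw : plane_drawing pt arc.
Implicit Types (e f g : edge G) (x y v w : vertex G).

Lemma arc_cases e s : 0 <= s <= 1 ->
  0 < s < 1 \/ exists2 x, x \in ends e & arc e s = pt x.
Proof.
have [u [v [eE e0 e1]]] := arc_ends Gdraw e.
move=> /andP[]; rewrite !le_eqVlt => /orP[/eqP <- _|s0 /orP[/eqP ->|s1]].
- by right; exists u; rewrite ?eE ?inE ?eqxx.
- by right; exists v; rewrite ?eE ?inE ?eqxx ?orbT.
- by left; rewrite s0.
Qed.

Lemma arcs_disjoint e f s t : [disjoint ends e & ends f] ->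
  0 <= s <= 1 -> 0 <= t <= 1 -> arc e s <> arc f t.
Proof.
move=> ef /(arc_cases e)[s01|[x xe ->]] /(arc_cases f)[t01|[y yf ->]].
- apply: (arc_disjoint Gdraw) => //; apply: contraTneq ef => ->.
  have [u [v [fE _ _]]] := arc_ends Gdraw f.
  by apply/pred0Pn; exists u => /=; rewrite fE !inE eqxx.
- exact: (arc_avoids_pt Gdraw).
- by move=> /esym; exact: (arc_avoids_pt Gdraw).
- move=> /(pt_inj Gdraw) xy; move: ef => /pred0P/(_ x) /=.
  by rewrite xe xy yf.
Qed.

(** One of the possibly parallel edges is chosen; the default [false] is never met for adjacent [x]
    and [y]. *)
Definition edge_winding n x y v :=
  if [pick e | ends e == [set x; y]%SET] is Some e then winding n (arc e) (pt v) else false.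

Lemma arc_ends2 e x y : x != y -> ends e = [set x; y]%SET ->
  arc e 0 = pt x /\ arc e 1 = pt y \/ arc e 0 = pt y /\ arc e 1 = pt x.
Proof.
move=> xy eE; have [u [v [eE' -> ->]]] := arc_ends Gdraw e.
have : u \in ends e by rewrite eE' !inE eqxx.
have : v \in ends e by rewrite eE' !inE eqxx orbT.
have : x \in ends e by rewrite eE !inE eqxx.
have : y \in ends e by rewrite eE !inE eqxx orbT.
rewrite {1 2}eE' eE !inE => yu xu /orP[]/eqP vE /orP[]/eqP uE; subst u v; auto.
  by move: yu xy; rewrite orbb eq_sym => ->.
by move: xu xy; rewrite orbb => ->.
Qed.

Lemma edge_winding_even : exists n, forall x y z t,
  adjacent x y -> adjacent z t -> uniq [:: x; y; z; t] ->
  ~~ odd (edge_winding n x y z + edge_winding n x y t + edge_winding n z t x + edge_winding n z t y +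
    lower (pt z - pt x) + lower (pt t - pt x) + lower (pt z - pt y) + lower (pt t - pt y)).
Proof.
pose grid e f (n : nat) := [disjoint ends e & ends f] ->
  forall i j, (i < n)%N -> (j < n)%N ->
     one_sided [seq arc e s - arc f t | t <- [:: j%:R / n%:R; j.+1%:R / n%:R],
                                       s <- [:: i%:R / n%:R; i.+1%:R / n%:R]].
(* One mesh serves all pairs, as there are finitely many edges. *)
have [n [n0 H]] : exists n, (0 < n)%N /\ forall e f, grid e f n.
  apply: (@filter_ex _ \oo%classic); apply: filterI; first exact: nbhs_infty_gt.
  refine (@filter_forall nat (edge G) (fun e n => forall f, grid e f n) \oo%classic _ _) => e.
  refine (@filter_forall nat (edge G) (grid e) \oo%classic _ _) => f.
  have [ef|ef] := boolP [disjoint ends e & ends f]; last first.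
    by apply: nearW => n ef'; rewrite ef' in ef.
  have := one_sided_grid (@arc_continuous _ _ _ _ Gdraw e) (@arc_continuous _ _ _ _ Gdraw f) (fun s t => arcs_disjoint ef).
  by apply: filterS => n H _.
exists n => x y z t /adjacentP[xy [e eE]] /adjacentP[zt [f fE]] U.
rewrite /edge_winding; case: pickP => [e' /eqP eE'|/(_ e)]; last by rewrite eE eqxx.
case: pickP => [f' /eqP fE'|/(_ f)]; last by rewrite fE eqxx.
have ef : [disjoint ends e' & ends f'].
  apply/pred0P => v /=; rewrite eE' fE' !inE; apply: contraTF U => /andP[/orP[]/eqP -> /orP[]/eqP ->];
  by rewrite /= !inE eqxx ?orbT ?andbF.
have := winding_grid n0 (H e' f' ef).
rewrite !oddD !oddb.
(* The direction of each arc is unknown, but the relation is symmetric under reversal. *)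
case: (arc_ends2 xy eE') => -[-> ->]; case: (arc_ends2 zt fE') => -[-> ->];
  move: (winding n (arc e') (pt z)) (winding n (arc e') (pt t))
    (winding n (arc f') (pt x)) (winding n (arc f') (pt y)) (lower (pt z - pt x))
    (lower (pt t - pt x)) (lower (pt z - pt y)) (lower (pt t - pt y));
  by do 8 case.
Qed.

Lemma drawing_no_subdivided_K33 : ~ subdivided_K33 (@adjacent G).
Proof.
have [n W] := edge_winding_even.
apply: (K33_parity (W := edge_winding n) (L := fun x z => lower (pt z - pt x))) => //.
move=> x y xy; rewrite addbC; apply: lowerBC.
by apply: contra_neq xy; exact: (pt_inj Gdraw).
Qed.

End Drawing.

Theorem corollary2 (R : realType) (G : multigraph)
    (Gplanar : planar R G) (Gloopless : loopless G)
    (Gdeg : (max_degree G <= 3)%N) :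
  exists M : {set edge G},
    induced_matching M /\ (#|edge G|%:R / 9%:R <= #|M|%:R :> rat).
Proof.
have [pt [arc Gdraw]] := Gplanar.
have deg3 x : (#|@adjacent G x| <= 3)%N.
  apply: leq_trans (card_adjacent x) (leq_trans _ Gdeg).
  exact: (leq_bigmax (F := @degree G)).
have [M adjM sM] := subcubic_matching (@adjacent_sym G) (@adjacent_irr G) deg3
  (drawing_no_subdivided_K33 Gdraw).
have [A [cA _ Aapart]] := edges_of_rmatching adjM.
exists A; split; first exact: edges_apart_induced.
rewrite ler_pdivrMr ?ltr0n // -natrM ler_nat cA.
(* With [n] non-isolated vertices, [2 |E| <= 3 n <= 18 |M|]. *)
have := card_edge_supp Gloopless Gdeg; lia.
Qed.
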